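(* Let $d,n\ge2$, $\mathcal X=\{0,1,\ldots,n-1\}^d$, $r\in\{1,\ldots,d-1\}$, and let the boundary be $\partial_r=\{x\in\mathcal X:r+1\le\rho(x)\le d\}$. Let $w_0,\ldots,w_d$, $P$ and the Green function $G_{1,\partial_r}$ (no killing, $\alpha=1$, i.e. $m=0$) be as in the context, and let $h_i=\{x\in\mathcal X:\rho(x)=i\}$, $i\in\{0,1,\ldots,d\}$. Then $$G_{1,\partial_r}(0,0)=\frac1{\sum_{i=1}^rw_ip_i+\sum_{i=r+1}^dw_i},$$ where $p=(p_i)_{i\in\{1,\ldots,r\}}$ solves the system of linear equations $$(I-\tilde P)p=\tilde p_\partial .$$ Here $(\tilde P)_{i,j\in\{1,\ldots,r\}}$ are the transition probabilities of the lumped chain of $P$ by Hamming distance from the origin, with state space $h_0,h_1,\ldots,h_d$, that is $(\tilde P)_{ij}=\sum_{x'\in h_j}(P)_{x,x'}$ for any $x\in h_i$ (for $i,j\in\{0,\ldots,d\}$), and $(\tilde p_\partial)_i=1-\sum_{j=0}^r(\tilde P)_{ij}$ for $i\in\{1,\ldots,r\}$.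
   Context: $\rho(x,x')=|\{i:x_i\ne x_i'\}|$ is the Hamming distance, $\rho(x)=\rho(0,x)$, $\kappa_i=\binom di(n-1)^i$. Let $w_i\ge0$, $\sum_{i=0}^dw_i=1$, and let $P$ be the stochastic matrix on $\mathcal X$ with $(P)_{x,x'}=w_{\rho(x,x')}/\kappa_{\rho(x,x')}$. Let $\mathcal Y=\mathcal X\setminus\partial_r$ and let $\hat P$ be the restriction of $P$ to $\mathcal Y\times\mathcal Y$. The Green function is $G_{1,\partial_r}(x,x')=\sum_{t=0}^\infty(\hat P^t)_{x,x'}=(I-\hat P)^{-1}_{x,x'}$ for $x,x'\in\mathcal Y$, i.e. the expected number of visits to $x'$ before hitting $\partial_r$ of the Markov chain with transition matrix $P$ started from $x$; it is assumed throughout that the largest eigenvalue modulus of $\hat P$ is strictly smaller than one. *)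

(* Defs.v *)
From HB Require Import structures.
From mathcomp Require Import all_boot all_order all_algebra all_fingroup.
From mathcomp Require Import all_classical all_reals all_analysis.
From mathcomp Require Import complex.

Set Implicit Arguments.
Unset Strict Implicit.
Unset Printing Implicit Defensive.

Import Order.TTheory GRing.Theory Num.Theory.
Local Open Scope ring_scope.

Notation hypercube d n := {ffun 'I_d -> 'I_n}.

Definition hamming (d n : nat) (x x' : hypercube d n) : nat :=
  #|[set i | x i != x' i]|.

Definition origin (d n : nat) (n_gt1 : (1 < n)%N) : hypercube d n :=
  [ffun=> Ordinal (ltnW n_gt1)].

Definition weight (d n : nat) (n_gt1 : (1 < n)%N) (x : hypercube d n) : nat :=
  hamming (origin d n_gt1) x.

Definition kappa (d n i : nat) : nat := 'C(d, i) * n.-1 ^ i.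

Definition transition (R : realType) (d n : nat) (w : nat -> R)
    (x x' : hypercube d n) : R :=
  w (hamming x x') / (kappa d n (hamming x x'))%:R.

Definition sphere (d n : nat) (n_gt1 : (1 < n)%N) (i : nat) :
    {set hypercube d n} :=
  [set x | weight n_gt1 x == i].

Definition boundary (d n : nat) (n_gt1 : (1 < n)%N) (r : nat) :
    {set hypercube d n} :=
  [set x | (r.+1 <= weight n_gt1 x <= d)%N].

Definition interior_states (d n : nat) (n_gt1 : (1 < n)%N) (r : nat) :
    {set hypercube d n} :=
  ~: boundary d n_gt1 r.

Lemma hamming_eq0 (d n : nat) (x y : hypercube d n) :
  (hamming x y == 0%N) = (x == y).
Proof.
apply/idP/eqP => [/eqP/card0_eq h | ->].
  by apply/ffunP => i; have := h i; rewrite inE => /negbFE/eqP.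
by apply/eqP/eq_card0 => i; rewrite inE eqxx.
Qed.

Lemma origin_interior (d n : nat) (n_gt1 : (1 < n)%N) (r : nat) :
  origin d n_gt1 \in interior_states d n_gt1 r.
Proof.
rewrite !inE negb_and; apply/orP; left.
suff -> : weight n_gt1 (origin d n_gt1) = 0%N by [].
by apply/eqP; rewrite hamming_eq0.
Qed.

Definition restricted_transition (R : realType) (d n : nat)
    (n_gt1 : (1 < n)%N) (r : nat) (w : nat -> R) :
    'M[R]_#|interior_states d n_gt1 r| :=
  \matrix_(i, j) transition w (enum_val i) (enum_val j).

(* Meaningful only for x and x' in interior_states: outside it, enum_rank_in
   returns a default index. The terms are nonnegative when w is, so the sum
   always exists in the extended reals. *)
Definition green (R : realType) (d n : nat) (n_gt1 : (1 < n)%N) (r : nat)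
    (w : nat -> R) (x x' : hypercube d n) : \bar R :=
  let idx := enum_rank_in (origin_interior d n_gt1 r) in
  (\sum_(0 <= t <oo)
     ((restricted_transition d n_gt1 r w ^+ t) (idx x) (idx x'))%:E)%E.

(* The sum is independent of the representative of the sphere of radius i, see
   lumped_transitionE. *)
Definition lumped_transition (R : realType) (d n : nat) (n_gt1 : (1 < n)%N)
    (w : nat -> R) (i j : nat) : R :=
  let x := odflt (origin d n_gt1) [pick x in sphere d n_gt1 i] in
  \sum_(x' in sphere d n_gt1 j) transition w x x'.

(* In the next two definitions, i : 'I_r stands for the distance i + 1. *)
Definition lumped_inner (R : realType) (d n : nat) (n_gt1 : (1 < n)%N)
    (r : nat) (w : nat -> R) : 'M[R]_r :=
  \matrix_(i < r, j < r) lumped_transition d n_gt1 w i.+1 j.+1.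

Definition lumped_exit (R : realType) (d n : nat) (n_gt1 : (1 < n)%N)
    (r : nat) (w : nat -> R) : 'cV[R]_r :=
  \col_(i < r) (1 - \sum_(0 <= j < r.+1) lumped_transition d n_gt1 w i.+1 j).

Lemma exists_perm_set (T : finType) (A B : {set T}) :
  #|A| = #|B| -> exists s : {perm T}, forall i, (s i \in B) = (i \in A).
Proof.
move=> cAB.
pose l (C : {set T}) := enum C ++ enum (~: C).
have lu C : uniq (l C).
  rewrite cat_uniq !enum_uniq /= andbT; apply/hasPn => i.
  by rewrite !mem_enum inE.
have lm C i : i \in l C by rewrite mem_cat !mem_enum inE orbN.
have sz C : size (l C) = #|T| by rewrite size_cat -!cardE cardsC.
pose f i := nth i (l B) (index i (l A)).
have il i : (index i (l A) < size (l B))%N by rewrite sz -(sz A) index_mem.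
have fi : injective f.
  move=> i j; rewrite /f (set_nth_default j) // => /eqP.
  rewrite nth_uniq // => /eqP e.
  by rewrite -(nth_index i (lm A i)) e nth_index.
exists (perm fi) => i; rewrite permE /f.
have -> : (i \in A) = (index i (l A) < #|A|)%N.
  rewrite /l index_cat mem_enum; case: ifP => iA.
    by rewrite cardE index_mem mem_enum iA.
  by rewrite -cardE ltnNge leq_addr.
rewrite cAB nth_cat -cardE; case: ltnP => h.
  by rewrite -mem_enum mem_nth // -cardE.
suff : nth i (enum (~: B)) (index i (l A) - #|B|) \in ~: B.
  by rewrite inE => /negbTE.
rewrite -mem_enum mem_nth // -cardE ltn_subLR // cardsC.
by move: (il i); rewrite sz.
Qed.

Lemma exists_isometry (d n : nat) (n_gt1 : (1 < n)%N) (x y : hypercube d n) :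
  weight n_gt1 x = weight n_gt1 y ->
  exists f : hypercube d n -> hypercube d n,
    [/\ bijective f, {mono f : u v / hamming u v},
        f (origin d n_gt1) = origin d n_gt1 & f x = y].
Proof.
move=> /exists_perm_set[s sP].
pose o := origin d n_gt1.
have {}sP i : (o (s i) == y (s i)) = (o i == x i).
  by apply: negb_inj; have := sP i; rewrite !inE.
pose f (z : hypercube d n) : hypercube d n :=
  [ffun k => let i := (s^-1)%g k in tperm (x i) (y k) (z i)].
have fm : {mono f : u v / hamming u v}.
  move=> u v; rewrite /hamming -[RHS](card_imset _ (@perm_inj _ s)).
  apply: eq_card => k; rewrite -{2}(permKV s k) mem_imset; last exact: perm_inj.
  by rewrite !inE !ffunE (inj_eq perm_inj).
have f_inj : injective f.
  by move=> u v e; apply/eqP; rewrite -hamming_eq0 -fm hamming_eq0 e.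
exists f; split => //; first exact: injF_bij.
  apply/ffunP => k; rewrite !ffunE /=.
  have := sP ((s^-1)%g k); rewrite permKV !ffunE.
  case: tpermP => [<- | <- | //]; first by rewrite eqxx => /eqP.
  by rewrite eqxx => /esym/eqP.
by apply/ffunP => k; rewrite !ffunE /= tpermL.
Qed.

Lemma lumped_transitionE (R : realType) (d n : nat) (n_gt1 : (1 < n)%N)
    (w : nat -> R) (i j : nat) (x : hypercube d n) :
  x \in sphere d n_gt1 i ->
  lumped_transition d n_gt1 w i j =
  \sum_(x' in sphere d n_gt1 j) transition w x x'.
Proof.
move=> xi; rewrite /lumped_transition; case: pickP => [y yi /= | /(_ x)].
  move: (xi) (yi); rewrite !inE => /eqP xw /eqP yw.
  have [f [fb fm fo fx]] := exists_isometry (etrans xw (esym yw)).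
  rewrite (reindex f) /=; last exact: onW_bij.
  apply: eq_big => z; first by rewrite !inE /weight -{1}fo fm.
  by move=> _; rewrite -fx /transition fm.
by rewrite xi.
Qed.

(* Main.v *)
Require Import Defs.
From HB Require Import structures.
From mathcomp Require Import all_boot all_order all_algebra.
From mathcomp Require Import all_classical all_reals all_analysis.
From mathcomp Require Import complex.
From mathcomp Require Import lra.

Set Implicit Arguments.
Unset Strict Implicit.
Unset Printing Implicit Defensive.

Import Order.TTheory GRing.Theory Num.Theory.
Import numFieldNormedType.Exports.
Local Open Scope ring_scope.

(* Write A for the restricted transition matrix. Since A is substochastic and 1
   is not an eigenvalue, 1 - A is invertible and A^t -> 0. A solution p of the
   linear system gives the probability of leaving the ball before visiting the
   origin, so g(x) = 1 - p_|x|, with g(0) = 1, is harmonic off the origin: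
   (1 - A) g = D delta_0, where D is the escape probability from the origin.
   Multiplying by 1 + A + ... + A^(t-1) and letting t -> oo gives
   D G(0,0) = g(0) = 1. *)

(** Points are sorted by the set [D] of coordinates where they differ from [x]: there are ['C(d, j)]
    sets of size [j], and each coordinate in [D] leaves [n.-1] values. *)
Lemma card_hamming_sphere (d n : nat) (x : hypercube d n) (j : nat) :
  #|[set y | hamming x y == j]| = kappa d n j.
Proof.
pose diff (y : hypercube d n) := [set i | x i != y i].
have cardD (D : {set 'I_d}) : #|[set y | diff y == D]| = (n.-1 ^ #|D|)%N.
  pose F i : pred 'I_n := if i \in D then predC1 (x i) else pred1 (x i).
  have -> : #|[set y | diff y == D]| = #|(family F : pred (hypercube d n))|.
    apply: eq_card => y; rewrite inE; apply/eqP/familyP => [yD i | yF].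
      by rewrite /F -yD inE; case: eqVneq => [->|xy]; rewrite inE ?eqxx // eq_sym.
    apply/setP => i; rewrite inE; have := yF i; rewrite /F.
    by case: ifP => _; rewrite inE eq_sym // => /eqP ->; rewrite eqxx.
  rewrite card_family foldrE big_image /= -prod_nat_const [RHS]big_mkcond.
  apply: eq_bigr => i _; rewrite /F; case: ifP => _; last exact: card1.
  by rewrite cardC1 card_ord.
rewrite -sum1_card (partition_big diff (fun D => #|D| == j)) => [|y]; last first.
  by rewrite inE.
have := card_draws 'I_d j; rewrite card_ord /kappa => <-; rewrite -sum_nat_const.
apply: eq_big => [D | D /eqP Dj]; first by rewrite inE.
rewrite -Dj -cardD -[RHS]sum1_card; apply: eq_bigl => y; rewrite !inE andbC.
by case: eqVneq => // <-; rewrite eqxx.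
Qed.

(** * Powers of a substochastic matrix and its Neumann series *)

Section SubstochasticMatrix.
Variables (R : realType) (n : nat) (A : 'M[R]_n).
Hypotheses (A_ge0 : forall i j, 0 <= A i j)
  (A_sum_le1 : forall i, \sum_j A i j <= 1) (A_unit : 1%:M - A \in unitmx).

Lemma exprmx_ge0 t i j : 0 <= (A ^+ t) i j.
Proof.
elim: t i j => [|t IHt] i j; first by rewrite expr0 mxE ler0n.
by rewrite exprS mxE sumr_ge0 // => k _; rewrite mulr_ge0.
Qed.

Lemma exprmx_sum_le1 t i : \sum_j (A ^+ t) i j <= 1.
Proof.
elim: t i => [|t IHt] i.
  rewrite expr0 (bigD1 i) //= big1 ?addr0 ?mxE ?eqxx // => j ji.
  by rewrite mxE eq_sym (negbTE ji).
under eq_bigr do rewrite exprS mxE.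
rewrite exchange_big /=; apply: le_trans (A_sum_le1 i).
by apply: ler_sum => k _; rewrite -mulr_sumr ler_piMr.
Qed.

Lemma exprmx_le1 t i j : (A ^+ t) i j <= 1.
Proof.
apply: le_trans (exprmx_sum_le1 t i).
by rewrite (bigD1 j) //= lerDl sumr_ge0 // => k _; apply: exprmx_ge0.
Qed.

Lemma geometric_sum_mx t :
  (\sum_(s < t) A ^+ s) *m (1%:M - A) = 1%:M - A ^+ t.
Proof.
elim: t => [|t IHt]; first by rewrite big_ord0 mul0mx expr0 subrr.
rewrite big_ord_recr mulmxDl IHt mulmxBr mulmx1 exprSr.
by rewrite addrA subrK.
Qed.

(* The partial sums of the Neumann series are (1 - A^t)(1 - A)^-1, hence
   bounded since the powers of A are. *)
Lemma cvg_exprmx_0 i j : ((A ^+ t) i j @[t --> \oo] --> (0 : R))%classic.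
Proof.
apply: cvg_series_cvg_0; apply: nondecreasing_is_cvgn.
  by apply: nondecreasing_series => k _ _; apply: exprmx_ge0.
exists (\sum_k `|invmx (1%:M - A) k j|) => _ [t _ <-].
rewrite /series /= big_mkord -summxE.
rewrite -[X in fun_of_matrix X](mulmxK A_unit).
rewrite geometric_sum_mx mxE; apply: ler_sum => k _.
rewrite (le_trans (ler_norm _)) // normrM ler_piMl //.
(* Entries of [1] and of [A ^+ t] both lie in [0, 1], so their difference has absolute value at most
   1. *)
have a0 := exprmx_ge0 t i k; have a1 := exprmx_le1 t i k.
by rewrite !mxE ler_norml; case: (i == k) => /=; lra.
Qed.

Lemma cvg_exprmx_mul_0 (v : 'cV[R]_n) i :
  ((A ^+ t *m v) i ord0 @[t --> \oo] --> (0 : R))%classic.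
Proof.
have -> : (fun t => (A ^+ t *m v) i ord0) =
           fun t => \sum_k (A ^+ t) i k * v k ord0.
  by apply/funext => t; rewrite mxE.
have c k (_ : true) : ((A ^+ t) i k * v k ord0 @[t --> \oo]
    --> 0 * v k ord0)%classic.
  by apply: cvgMr_tmp; apply: cvg_exprmx_0.
have := cvg_big (op := +%R) (x0 := 0) (r := index_enum 'I_n)
  (@add_continuous R) _ c.
rewrite (_ : \sum_(k < n) 0 * v k ord0 = 0); first by apply.
by rewrite big1 // => k _; rewrite mul0r.
Qed.

(** Since [A] preserves inequalities, [v <= A v] iterates to [v <= A ^+ t v], whose right side tends
    to 0. *)
Lemma subharmonic_le0 (v : 'cV[R]_n) :
  (forall i, v i ord0 <= (A *m v) i ord0) -> forall i, v i ord0 <= 0.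
Proof.
move=> vA i; have vAt t : v i ord0 <= (A ^+ t *m v) i ord0.
  elim: t => [|t IHt]; first by rewrite expr0 mul1mx.
  apply: le_trans IHt _; rewrite exprSr -mulmxA !mxE; apply: ler_sum => k _.
  by rewrite ler_wpM2l ?exprmx_ge0.
have cv := cvg_exprmx_mul_0 v i.
rewrite -(cvg_lim (@Rhausdorff R) cv); apply: limr_ge; first exact: cvgP cv.
by apply: nearW => t; apply: vAt.
Qed.

(** The partial sums telescope to [g - A ^+ t g]. Keeping [c] as a factor allows [c = 0], which the
    main proof excludes afterwards by this very limit. *)
Lemma potential_series (g : 'cV[R]_n) (c : R) (i : 'I_n) :
  (1%:M - A) *m g = c *: delta_mx i ord0 ->
  ((c * \sum_(0 <= s < t) (A ^+ s) i i) @[t --> \oo] --> g i ord0)%classic.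
Proof.
move=> gE; rewrite -[g i ord0]subr0.
have E t : c * \sum_(0 <= s < t) (A ^+ s) i i =
           g i ord0 - (A ^+ t *m g) i ord0.
  rewrite big_mkord -summxE.
  have := congr1 (mulmx (\sum_(s < t) A ^+ s)) gE.
  rewrite mulmxA geometric_sum_mx mulmxBl mul1mx -scalemxAr -colE.
  by move=> /matrixP/(_ i ord0); rewrite !mxE => ->.
rewrite (funext E).
by apply: cvgB; [exact: cvg_cst | exact: cvg_exprmx_mul_0].
Qed.

End SubstochasticMatrix.

(** * Radial functions on the ball and the lumped chain *)

Section RadialFunctions.
Variables (R : realType) (d n r : nat) (w : nat -> R) (n_gt1 : (1 < n)%N).
Hypotheses (r_ltd : (r < d)%N)
  (w_ge0 : forall i : nat, (i <= d)%N -> 0 <= w i)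
  (w_sum1 : \sum_(0 <= i < d.+1) w i = 1).

Local Notation A := (restricted_transition d n_gt1 r w).
Local Notation Pt := (lumped_inner d n_gt1 r w).
Local Notation pd := (lumped_exit d n_gt1 r w).
Local Notation wt := (weight n_gt1).

Lemma hamming_le (x y : hypercube d n) : (hamming x y <= d)%N.
Proof. by rewrite -{2}(card_ord d); apply: max_card. Qed.

Lemma kappa_gt0 j : (j <= d)%N -> (0 < kappa d n j)%N.
Proof.
by move=> jd; rewrite muln_gt0 bin_gt0 jd expn_gt0 -ltnS prednK ?n_gt1 // ltnW.
Qed.

(** The normalisation [kappa d n j] is exactly the size of the sphere of radius [j] around [x]. *)
Lemma sum_transition_hamming (x : hypercube d n) j : (j <= d)%N ->
  \sum_(y | hamming x y == j) transition w x y = w j.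
Proof.
move=> jd; under eq_bigr => y /eqP xy do rewrite /transition xy.
rewrite sumr_const -[X in _ *+ X](_ : kappa d n j = _); last first.
  by rewrite -(card_hamming_sphere x); apply: eq_card => y; rewrite !inE.
by rewrite -[LHS]mulr_natr mulfVK // pnatr_eq0 -lt0n kappa_gt0.
Qed.

Lemma sum_transition (x : hypercube d n) : \sum_y transition w x y = 1.
Proof.
rewrite (partition_big (fun y => inord (hamming x y) : 'I_d.+1) predT) //=.
rewrite -w_sum1 big_mkord; apply: eq_bigr => j _.
rewrite -(@sum_transition_hamming x) -1?ltnS //; apply: eq_bigl => y.
by rewrite -val_eqE /= inordK // ltnS hamming_le.
Qed.

Lemma transition_ge0 (x y : hypercube d n) : 0 <= transition w x y.
Proof. by rewrite divr_ge0 ?w_ge0 ?hamming_le ?ler0n. Qed.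

Lemma mem_interior (x : hypercube d n) :
  (x \in interior_states d n_gt1 r) = (wt x <= r)%N.
Proof. by rewrite !inE hamming_le andbT -leqNgt. Qed.

Lemma weight_interior (i : 'I_#|interior_states d n_gt1 r|) :
  (wt (enum_val i) <= r)%N.
Proof. by rewrite -mem_interior enum_valP. Qed.

Lemma restricted_transition_ge0 i j : 0 <= A i j.
Proof. by rewrite mxE transition_ge0. Qed.

Lemma restricted_transition_sum_le1 i : \sum_j A i j <= 1.
Proof.
under eq_bigr do rewrite mxE.
rewrite -(big_enum_val (fun y => transition w (enum_val i) y)) /=.
rewrite -(sum_transition (enum_val i)) [leLHS]big_mkcond /=.
by apply: ler_sum => y _; case: ifP => // _; rewrite transition_ge0.
Qed.

Definition radial (q : nat -> R) : 'cV[R]_#|interior_states d n_gt1 r| :=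
  \col_i q (wt (enum_val i)).

(** Grouping the states of the ball by weight turns row [i] of [A] into lumped probabilities, for
    which [enum_val i] may serve as representative. *)
Lemma mul_radial (q : nat -> R) i :
  (A *m radial q) i ord0 =
  \sum_(j < r.+1) lumped_transition d n_gt1 w (wt (enum_val i)) j * q j.
Proof.
rewrite mxE; under eq_bigr do rewrite !mxE.
rewrite -(big_enum_val (fun y => transition w (enum_val i) y * q (wt y))).
rewrite (partition_big (fun y => inord (wt y) : 'I_r.+1) predT) //=.
apply: eq_bigr => j _.
rewrite (@lumped_transitionE _ _ _ _ _ _ _ (enum_val i)) ?inE //.
rewrite mulr_suml; apply: eq_big => y.
  rewrite mem_interior !inE -val_eqE /=.
  case: leqP => wr /=; first by rewrite inordK.
  (* A state of weight above [r] is on no sphere of radius [j <= r], so the default value of [inord]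
     does no harm. *)
  by apply/esym/negbTE; rewrite neq_ltn (leq_trans (ltn_ord j)) ?orbT.
by case/andP => yI /eqP <-; rewrite inordK // ltnS -mem_interior.
Qed.

(* Extends p by 0 to the origin, where the equations for p do not hold. *)
Definition extend (p : 'cV[R]_r) (k : nat) : R :=
  if k is j.+1 then oapp (p^~ ord0) 0 (insub j) else 0.

Lemma extend0 p : extend p 0 = 0.
Proof. by []. Qed.

Lemma extendS p (j : 'I_r) : extend p j.+1 = p j ord0.
Proof. by rewrite /extend valK. Qed.

Lemma weight_cases i : wt (enum_val i) = 0%N \/
  exists k : 'I_r, wt (@enum_val _ (interior_states d n_gt1 r) i) = k.+1.
Proof.
have := weight_interior i; case: (wt _) => [|k kr]; first by left.
by right; exists (Ordinal kr).
Qed.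

(** The value 0 at the origin removes the term [j = 0], which [Pt] does not contain. *)
Lemma mul_radial_extend p i (k : 'I_r) : wt (enum_val i) = k.+1 ->
  (A *m radial (extend p)) i ord0 = (Pt *m p) k ord0.
Proof.
move=> ik; rewrite mul_radial ik big_ord_recl extend0 mulr0 add0r mxE.
by apply: eq_bigr => j _; rewrite lift0 extendS mxE.
Qed.

Lemma exists_interior_weight k : (k <= r)%N ->
  exists i : 'I_#|interior_states d n_gt1 r|, wt (enum_val i) = k.
Proof.
move=> kr; have : (0 < #|[set y | hamming (origin d n_gt1) y == k]|)%N.
  by rewrite card_hamming_sphere kappa_gt0 // (leq_trans kr) // ltnW.
case/card_gt0P => y; rewrite inE => /eqP yk.
have yI : y \in interior_states d n_gt1 r by rewrite mem_interior /weight yk.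
by exists (enum_rank_in yI y); rewrite enum_rankK_in.
Qed.

(* If Pt p = p, then v(x) = |p_|x||, with v(0) = 0, satisfies v <= A v, hence
   v <= A^t v -> 0. *)
Lemma lumped_inner_unit : 1%:M - A \in unitmx -> 1%:M - Pt \in unitmx.
Proof.
move=> A_unit; rewrite -unitmx_tr -row_free_unit -kermx_eq0.
apply/rowV0P => u /sub_kermxP uP.
pose p := u^T; have pP : Pt *m p = p.
  apply/esym/eqP; rewrite -subr_eq0 -{1}[p]mul1mx -mulmxBl.
  by rewrite -[_ *m _]trmxK trmx_mul trmxK uP trmx0.
pose v := radial (fun k => `|extend p k|).
have v0 i : v i ord0 <= 0.
  apply: (subharmonic_le0 restricted_transition_ge0
            restricted_transition_sum_le1 A_unit) => {}i.
  case: (weight_cases i) => [i0 | [k ik]].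
    rewrite mxE i0 normr0 mxE sumr_ge0 // => j _.
    by rewrite mulr_ge0 ?restricted_transition_ge0 // mxE.
  rewrite mxE ik extendS -pP -(mul_radial_extend _ ik) !mxE.
  apply: le_trans (ler_norm_sum _ _ _) _; apply: ler_sum => j _.
  by rewrite normrM !mxE ger0_norm ?transition_ge0.
apply/rowP => k; have [i ik] := exists_interior_weight (ltn_ord k).
by have := v0 i; rewrite mxE ik extendS normr_le0 !mxE => /eqP.
Qed.

Lemma lumped_transition0 j : (j <= d)%N ->
  lumped_transition d n_gt1 w 0 j = w j.
Proof.
move=> jd; rewrite (@lumped_transitionE _ _ _ _ _ _ _ (origin d n_gt1)).
  rewrite -(sum_transition_hamming (origin d n_gt1) jd).
  by apply: eq_bigl => y; rewrite inE.
by rewrite inE /weight hamming_eq0.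
Qed.

(** At weight [k.+1] the entry vanishes by row [k] of the linear system. At the origin there remain
    the probability of jumping out at once and that of jumping to a weight in 1..r, weighted by
    [p]. *)
Lemma poisson_radial (p : 'cV[R]_r) (i : 'I_#|interior_states d n_gt1 r|) :
  (1%:M - Pt) *m p = pd -> wt (enum_val i) = 0%N ->
  (1%:M - A) *m radial (fun k => 1 - extend p k) =
  (\sum_(i < r) w i.+1 * p i ord0 + \sum_(r.+1 <= i < d.+1) w i)
    *: delta_mx i ord0.
Proof.
move=> pP i0; apply/colP => i'.
(* By linearity: the constant 1 contributes the one-step exit probability, and [extend p]
   contributes its own defect from harmonicity. *)
have -> : ((1%:M - A) *m radial (fun k => 1 - extend p k)) i' ord0 =
  1 - \sum_(j < r.+1) lumped_transition d n_gt1 w (wt (enum_val i')) j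
  - (extend p (wt (enum_val i')) - (A *m radial (extend p)) i' ord0).
  rewrite mulmxBl mul1mx [LHS]mxE [X in _ + X]mxE !mul_radial mxE.
  under eq_bigr do rewrite mulrBr mulr1.
  by rewrite sumrB; lra.
rewrite [RHS]mxE [delta_mx _ _ _ _]mxE eqxx andbT.
case: (weight_cases i') => [i'0 | [k i'k]].
  have -> : i' = i.
    apply: enum_val_inj; move/eqP: i'0; move/eqP: i0.
    by rewrite /weight !hamming_eq0 => /eqP <- /eqP <-.
  rewrite eqxx mulr1 i0 extend0 sub0r opprK.
  have -> : (A *m radial (extend p)) i ord0 = \sum_(i < r) w i.+1 * p i ord0.
    rewrite mul_radial i0 big_ord_recl extend0 mulr0 add0r; apply: eq_bigr => j _.
    rewrite lift0 extendS lumped_transition0 //.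
    exact: leq_trans (ltn_ord j) (ltnW r_ltd).
  rewrite addrC; congr (_ + _).
  (* Splitting the total mass 1 of [w] after index [r] leaves the mass of the jumps that exit
     directly. *)
  rewrite -w_sum1 (big_cat_nat (n := r.+1)) //= ?leqW // addrAC.
  rewrite big_mkord -[RHS]add0r; congr (_ + _); apply/eqP; rewrite subr_eq0.
  apply/eqP/eq_bigr => j _; rewrite lumped_transition0 //.
  by rewrite -ltnS (leq_trans (ltn_ord j)) // ltnS ltnW.
have -> : (i' == i) = false.
  by apply/negbTE; apply: contra_eq_neq i'k => ->; rewrite i0.
rewrite mulr0 (mul_radial_extend _ i'k) i'k extendS.
have := congr1 (fun M : 'cV_r => M k ord0) pP.
by rewrite mulmxBl mul1mx [LHS]mxE [X in _ + X]mxE [RHS]mxE big_mkord => ->; rewrite subrr.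
Qed.

End RadialFunctions.

(** * The Green function at the origin *)

Theorem lemma2p8 (R : realType) (d n r : nat) (w : nat -> R)
  (d_gt1 : (1 < d)%N) (n_gt1 : (1 < n)%N)
  (r_gt0 : (0 < r)%N) (r_ltd : (r < d)%N)
  (w_ge0 : forall i : nat, (i <= d)%N -> 0 <= w i)
  (w_sum1 : \sum_(0 <= i < d.+1) w i = 1)
  (eigen_lt1 : forall z : R[i],
     eigenvalue
       (map_mx (fun a : R => a%:C%C)
          (restricted_transition d n_gt1 r w)) z ->
     `|z| < 1) :
  let Pt := lumped_inner d n_gt1 r w in
  let pd := lumped_exit d n_gt1 r w in
  (exists p : 'cV[R]_r, (1%:M - Pt) *m p = pd) /\
  (forall p : 'cV[R]_r, (1%:M - Pt) *m p = pd ->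
     green n_gt1 r w (origin d n_gt1) (origin d n_gt1) =
     (1 / (\sum_(i < r) w i.+1 * p i ord0
           + \sum_(r.+1 <= i < d.+1) w i))%:E).
Proof.
have A_unit : 1%:M - restricted_transition d n_gt1 r w \in unitmx.
  (* A nonzero kernel of [A - 1] would make 1 an eigenvalue, also over the complex numbers, against
     the bound on moduli. *)
  rewrite -opprB -scaleN1r unitmxZ ?unitrN1 // -row_free_unit -kermx_eq0.
  apply: contraT => ev; have := eigen_lt1 1.
  rewrite normr1 ltxx; apply.
  by rewrite -(rmorph1 (real_complex R)) eigenvalue_map.
have A_ge0 := @restricted_transition_ge0 R d n r w n_gt1 w_ge0.
have A_sum := @restricted_transition_sum_le1 R d n r w n_gt1 w_ge0 w_sum1.
move=> Pt pd; split.
  exists (invmx (1%:M - Pt) *m pd); rewrite mulmxA mulmxV ?mul1mx //.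
  exact: (lumped_inner_unit r_ltd w_ge0 w_sum1 A_unit).
move=> p pP; set D := _ + _.
rewrite /green; set o := enum_rank_in _ _.
have o0 : weight n_gt1 (enum_val o) = 0%N.
  by rewrite enum_rankK_in ?origin_interior //; apply/eqP; rewrite hamming_eq0.
have := potential_series A_ge0 A_sum A_unit
  (poisson_radial r_ltd w_sum1 pP o0).
rewrite -/D mxE o0 /= subr0 => DS.
(* If [D] were 0, the sequence in [DS] would be constantly 0 and yet converge to 1. *)
have D0 : D != 0.
  apply/eqP => D0; move: DS; under eq_fun do rewrite D0 mul0r.
  move=> /(cvg_lim (@Rhausdorff R))/eqP.
  by rewrite (lim_cst (@Rhausdorff R)) eq_sym oner_eq0.
pose S t := \sum_(0 <= s < t) (restricted_transition d n_gt1 r w ^+ s) o o.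
have cS : (S t @[t --> \oo] --> D^-1)%classic.
  rewrite -[D^-1]mulr1 -(funext (fun t => mulKf D0 (S t))).
  exact: cvgMl_tmp DS.
rewrite div1r -(cvg_lim (@Rhausdorff R) cS) -EFin_lim; last exact: cvgP cS.
by congr (limn _); apply/funext => t /=; rewrite sumEFin.
Qed.
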